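(* Let $M^{1,0}$ be the $n$-dimensional complex Leibniz algebra with basis $e_1,\dots,e_n$ and products $[e_1,e_1]=e_n$, $[e_i,e_1]=e_{i+1}$ for $2\le i\le n-2$ (all other products zero). Every $(n+2)$-dimensional complex solvable Leibniz algebra whose nilradical is $M^{1,0}$ is isomorphic to the algebra with basis $e_1,\dots,e_n,x_1,x_2$, with the products of $M^{1,0}$ among $e_1,\dots,e_n$, and with $$[e_1,x_1]=e_1,\quad [e_i,x_1]=(i-2)e_i\ (3\le i\le n-1),\quad [e_n,x_1]=2e_n,\quad [x_1,e_1]=-e_1,\quad [e_i,x_2]=e_i\ (2\le i\le n-1),$$ all remaining products being zero.
   Context: All algebras are finite-dimensional over $\mathbb{C}$. A (right) Leibniz algebra is a vector space with a bilinear bracket satisfying $[x,[y,z]]=[[x,y],z]-[[x,z],y]$. With $L^{[1]}=L$, $L^{[s+1]}=[L^{[s]},L^{[s]}]$ and $L^1=L$, $L^{k+1}=[L^k,L]$, the algebra $L$ is solvable if some $L^{[m]}=0$ and nilpotent if some $L^k=0$. The nilradical is the maximal nilpotent ideal.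
   Formalization: Proved for n ≥ 4: for n = 3 the claim fails, since adding the product [x_2,e_2] = -e_2 gives a non-isomorphic solvable algebra with the same nilradical, and for n ≤ 2 no such algebra exists. *)

(* Defs.v *)
From mathcomp Require Import all_boot all_order all_algebra.
From mathcomp Require Export complex.
From mathcomp Require Import reals.

Set Implicit Arguments.
Unset Strict Implicit.
Unset Printing Implicit Defensive.
Import GRing.Theory.
Local Open Scope ring_scope.

Section Leibniz.
Variables (K : fieldType) (L : vectType K) (br : {bilinear L -> L -> L}).

(* Right Leibniz identity: every right multiplication is a derivation. *)
Definition leibniz_identity : Prop :=
  forall x y z : L, br x (br y z) = br (br x y) z - br (br x z) y.

(* [U, V], the linear span of all br u v; since br is bilinear, bases of U and
   V suffice (as in falgebra.prodv). *)
Definition brv (U V : {vspace L}) : {vspace L} :=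
  <<allpairs br (vbasis U) (vbasis V)>>%VS.

(* Both series are numbered from 0: derived_series U s is U^[s+1] and
   lower_central_series U k is U^(k+1). *)
Definition derived_series (U : {vspace L}) (s : nat) : {vspace L} :=
  iter s (fun V => brv V V) U.

Definition lower_central_series (U : {vspace L}) (k : nat) : {vspace L} :=
  iter k (fun V => brv V U) U.

Definition solvable (U : {vspace L}) : Prop :=
  exists s, derived_series U s = 0%VS.

Definition nilpotent (U : {vspace L}) : Prop :=
  exists k, lower_central_series U k = 0%VS.

Definition ideal (U : {vspace L}) : Prop :=
  forall u x : L, u \in U -> br u x \in U /\ br x u \in U.

Definition nilradical (N : {vspace L}) : Prop :=
  [/\ ideal N, nilpotent N
    & forall I : {vspace L}, ideal I -> nilpotent I -> (I <= N)%VS].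

End Leibniz.

(* The algebra (A, brA) is isomorphic to the subspace U of B with the bracket
   brB; U is then a subalgebra of B, and U = fullv gives A isomorphic to B. *)
Definition isomorphic_onto (K : fieldType) (A B : vectType K)
    (brA : A -> A -> A) (brB : B -> B -> B) (U : {vspace B}) : Prop :=
  exists f : 'Hom(A, B),
    [/\ lker f = 0%VS, limg f = U
      & forall x y : A, f (brA x y) = brB (f x) (f y)].

Section Models.
Variable K : fieldType.

(* The standard basis of K^m with 1-based numbering: 1 <= i <= m. *)
Definition ebas (m i : nat) : 'rV[K]_m := \row_(j < m) (j.+1 == i)%:R.

(* The bilinear bracket on K^m whose value at (ebas m i, ebas m j) is t i j. *)
Definition table_bracket (m : nat) (t : nat -> nat -> 'rV[K]_m)
    (x y : 'rV[K]_m) : 'rV[K]_m :=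
  \sum_(i < m) \sum_(j < m) (x 0 i * y 0 j) *: t i.+1 j.+1.

(* The products of e_1, ..., e_n in M^{1,0}, valued in K^m with n <= m so that
   the same table serves for M^{1,0} and for its extension. *)
Definition M10_table (n m i j : nat) : 'rV[K]_m :=
  if (i == 1)%N && (j == 1)%N then ebas m n
  else if (2 <= i <= n - 2)%N && (j == 1)%N then ebas m i.+1
  else 0.

Definition M10_bracket (n : nat) := table_bracket (M10_table n n).

(* On K^(n+2), x_1 and x_2 are the basis vectors numbered n+1 and n+2. *)
Definition ext_table (n i j : nat) : 'rV[K]_(n + 2) :=
  let e := ebas (n + 2) in
  if (i <= n)%N && (j <= n)%N then M10_table n (n + 2) i j
  else if (j == n + 1)%N then
    if (i == 1)%N then e 1%N
    else if (3 <= i <= n - 1)%N then (i - 2)%:R *: e i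
    else if (i == n)%N then 2 *: e n
    else 0
  else if (j == n + 2)%N then
    if (2 <= i <= n - 1)%N then e i else 0
  else if (i == n + 1)%N && (j == 1)%N then - e 1%N
  else 0.

Definition ext_bracket (n : nat) := table_bracket (ext_table n).

End Models.

(* Main.v *)
Require Import Defs.
From HB Require Import structures.
From mathcomp Require Import all_boot all_order all_algebra.
From mathcomp Require Import complex reals ring zify.

Set Implicit Arguments.
Unset Strict Implicit.
Unset Printing Implicit Defensive.
Import GRing.Theory.
Local Open Scope ring_scope.

(**
  Every right multiplication R_y restricts to a derivation of the nilradical N,
  and derivations of M^{1,0} are triangular in the order e_1, e_2, e_n, e_3, ...,
  e_(n-1), with diagonal a, d, 2a, d + a, d + 2a, ..., where a and d are linear
  forms in y. They vanish on [L, L], and an ideal that contains N, lies in their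
  common kernel and has its square in N is nilpotent, hence equal to N. This
  applies first to [L, L] + N, where solvability and dim L/N = 2 put the square
  in N, and then to the common kernel itself. So [L, L] is contained in N and
  (a, d) identifies L/N with K^2.

  Choose h with (a, d) = (1, n). Then R_h is invertible on N with distinct
  eigenvalues, so its kernel is an abelian complement of N, which gives x_1 and
  x_2. Eigenvectors of R_h deforming e_1 and e_2 generate a new basis of N in
  which all R_x, x in the kernel of R_h, are diagonal, and the left
  multiplications are then forced by the Leibniz identity.
*)

(** * Vector identities and brackets of subspaces *)

(** Coordinates in a basis are linear forms, so linear forms separate vectors. An identity of
    vectors thus becomes one of scalars, within reach of [ring]. *)
Lemma linear_form_ext (K : fieldType) (L : vectType K) (u v : L) :
  (forall f : L -> K, (forall x y, f (x + y) = f x + f y) ->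
     (forall x, f (- x) = - f x) -> (forall a x, f (a *: x) = a * f x) ->
     f u = f v) -> u = v.
Proof.
move=> eq_uv; rewrite (coord_vbasis (memvf u)) (coord_vbasis (memvf v)).
apply: eq_bigr => i _; congr (_ *: _).
by apply: eq_uv => [x y|x|a x]; rewrite ?linearD ?linearN ?linearZ.
Qed.

(* Decides the equations of vectors that hold in every vector space. *)
Ltac lmod_ring :=
  let f := fresh "f" in
  let fD := fresh "fD" in let fN := fresh "fN" in let fZ := fresh "fZ" in
  apply: linear_form_ext => f fD fN fZ; rewrite ?(fD, fN, fZ); ring.

Lemma memv_cast (K : fieldType) (L : vectType K) (U : {vspace L}) u v :
  u \in U -> v = u -> v \in U.
Proof. by move=> Uu ->. Qed.

Section BracketOfSubspaces.
Variables (K : fieldType) (L : vectType K) (br : {bilinear L -> L -> L}).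

Lemma bracketDl x y z : br (x + y) z = br x z + br y z.
Proof. exact: linearDl. Qed.

Lemma bracketDr x y z : br x (y + z) = br x y + br x z.
Proof. exact: linearDr. Qed.

Lemma bracketBl x y z : br (x - y) z = br x z - br y z.
Proof. exact: linearBl. Qed.

Lemma bracketZl a u v : br (a *: u) v = a *: br u v.
Proof. exact: linearZl_LR. Qed.

Lemma bracketZr a u v : br u (a *: v) = a *: br u v.
Proof. exact: linearZr_LR. Qed.

Lemma bracket_suml I r (P : pred I) E v :
  br (\sum_(i <- r | P i) E i) v = \sum_(i <- r | P i) br (E i) v.
Proof. exact: (linear_sum (applyr br v)). Qed.

Lemma bracket_sumr I r (P : pred I) E u :
  br u (\sum_(i <- r | P i) E i) = \sum_(i <- r | P i) br u (E i).
Proof. exact: (linear_sum (br u)). Qed.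

Lemma memv_brv (U V : {vspace L}) u v :
  u \in U -> v \in V -> br u v \in brv br U V.
Proof.
move=> /coord_vbasis-> /coord_vbasis->.
rewrite bracket_suml memv_suml // => i _; rewrite bracketZl memvZ //.
rewrite bracket_sumr memv_suml // => j _; rewrite bracketZr memvZ // memv_span //.
by apply/allpairsP; exists ((vbasis U)`_i, (vbasis V)`_j); rewrite !memt_nth.
Qed.

Lemma brvP (U V W : {vspace L}) :
  reflect (forall u v, u \in U -> v \in V -> br u v \in W) (brv br U V <= W)%VS.
Proof.
apply: (iffP idP) => [sUVW u v Uu Vv | sUVW].
  by rewrite (subvP sUVW) ?memv_brv.
apply/span_subvP=> _ /allpairsP[[u v] /= [Uu Vv ->]].
by rewrite sUVW ?vbasis_mem.
Qed.

Lemma brvS (U U' V V' : {vspace L}) :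
  (U <= U')%VS -> (V <= V')%VS -> (brv br U V <= brv br U' V')%VS.
Proof.
by move=> sU sV; apply/brvP=> u v /(subvP sU) ? /(subvP sV) ?; apply: memv_brv.
Qed.

Lemma derived_series_le (U V : {vspace L}) s :
  (U <= V)%VS -> (derived_series br U s <= derived_series br V s)%VS.
Proof. by move=> sUV; elim: s => //= s IH; apply: brvS. Qed.

(** Modulo [N], the subspace [U] lies in its own square, hence by induction in every term of its
    derived series; solvability makes a late term vanish. *)
Lemma solvable_sub_brv (U N : {vspace L}) :
  solvable br fullv -> ideal br N -> (U <= brv br U U + N)%VS -> (U <= N)%VS.
Proof.
move=> [s Ls0] idN sU.
suff sUs: (U <= derived_series br U s + N)%VS.
  apply: subv_trans sUs _; rewrite subv_add subvv andbT.
  by apply: subv_trans (derived_series_le s (subvf U)) _; rewrite Ls0 sub0v.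
elim: s {Ls0} => [|s IH] /=; first exact: addvSl.
apply: subv_trans sU _; rewrite subv_add addvSr andbT; apply/brvP=> u v.
move=> /(subvP IH)/memv_addP[u1 Du1 [u2 Nu2 ->]].
move=> /(subvP IH)/memv_addP[v1 Dv1 [v2 Nv2 ->]].
rewrite linearDl linearDr -addrA memv_add ?memv_brv // memvD //.
  by have [] := idN v2 u1 Nv2.
by have [] := idN u2 (v1 + v2) Nu2.
Qed.

End BracketOfSubspaces.

(** * Flags, triangular operators and their eigenvectors *)

Section Flag.
Variables (K : fieldType) (L : vectType K) (n : nat) (b : nat -> L).

Definition flag k : {vspace L} := <<[seq b j | j <- iota k (n - k)]>>%VS.

Hypothesis b_out : forall k, (n <= k)%N -> b k = 0.
Hypothesis b_free : free [seq b j | j <- iota 0 n].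

Lemma flag_out k : (n <= k)%N -> flag k = 0%VS.
Proof. by rewrite /flag -subn_eq0 => /eqP->; rewrite span_nil. Qed.

Lemma flagS k : flag k = (<[b k]> + flag k.+1)%VS.
Proof.
have [kn|nk] := ltnP k n; first by rewrite /flag -(subnSK kn) /= span_cons.
by rewrite !flag_out ?(leqW nk) // b_out // addv0; apply/esym/eqP; rewrite -subv0 -memvE mem0v.
Qed.

Lemma flag_decomp k v :
  v \in flag k -> exists c w, w \in flag k.+1 /\ v = c *: b k + w.
Proof.
by rewrite flagS => /memv_addP[_ /vlineP[c ->] [w Vw ->]]; exists c, w.
Qed.

Lemma mem_flagS k v : v \in flag k.+1 -> v \in flag k.
Proof. by apply: subvP; rewrite (flagS k) addvSr. Qed.

Lemma mem_flag_le k m v : (k <= m)%N -> v \in flag m -> v \in flag k.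
Proof.
by move/subnK<-; elim: (m - k)%N => // i IH; rewrite addSn => /mem_flagS.
Qed.

Lemma mem_flag_b k m : (k <= m)%N -> b m \in flag k.
Proof.
by move=> km; apply: mem_flag_le km _; rewrite flagS memvE addvSl.
Qed.

Lemma flag_indep k c : (k < n)%N -> c *: b k \in flag k.+1 -> c = 0.
Proof.
move=> kn Vb; apply/eqP/contraT => c0.
have {Vb} Vb: b k \in flag k.+1 by rewrite -(scalerK c0 (b k)) memvZ.
have: free (drop k [seq b j | j <- iota 0 n]).
  by move: b_free; rewrite -{1}(cat_take_drop k [seq b j | j <- iota 0 n]) => /catr_free.
rewrite -map_drop drop_iota add0n -(subnSK kn) /= free_cons => /andP[].
by rewrite -/(flag k.+1) Vb.
Qed.

(** Downward induction, starting from the zero end of the flag. *)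
Lemma flag_ind (P : nat -> Prop) :
  (forall k, (n <= k)%N -> P k) -> (forall k, (k < n)%N -> P k.+1 -> P k) ->
  forall k, P k.
Proof.
move=> Pout PS k; have [m] := ubnP (n - k)%N; elim: m k => // m IH k nkm.
have [kn|nk] := ltnP k n; last exact: Pout.
by apply: PS => //; apply: IH; rewrite -(subnSK kn) in nkm.
Qed.

Lemma flag_span_unitri (g : nat -> L) (U : {vspace L}) :
  (forall k, (k < n)%N -> g k - b k \in flag k.+1) ->
  (forall k, (k < n)%N -> g k \in U) -> forall k, (flag k <= U)%VS.
Proof.
move=> Hg HU; apply: flag_ind => [k nk|k kn IH]; first by rewrite flag_out ?sub0v.
rewrite flagS subv_add IH andbT -memvE.
by rewrite -(subrK (g k) (b k)) -opprB memvD ?HU // memvN (subvP IH) ?Hg.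
Qed.

Section Triangular.
Variables (T : {linear L -> L}) (lam : nat -> K).
Hypothesis T_flag : forall k, (k < n)%N -> T (b k) - lam k *: b k \in flag k.+1.

Lemma flag_stable k v : v \in flag k -> T v \in flag k.
Proof.
elim/flag_ind: k v => [k nk v|k kn IH v].
  by rewrite flag_out // memv0 => /eqP->; rewrite linear0 mem0v.
move=> /flag_decomp[c [w [Vw ->]]]; rewrite linearD linearZ /=.
rewrite memvD ?(mem_flagS (IH _ Vw)) // memvZ //.
by rewrite -(subrK (lam k *: b k) (T _)) memvD ?memvZ ?mem_flag_b // mem_flagS ?T_flag.
Qed.

(** Back substitution: dividing by [lam k] settles the leading coefficient and leaves an equation in
    [flag k.+1]. *)
Lemma flag_surj k :
  (forall j, (k <= j < n)%N -> lam j != 0) ->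
  forall v, v \in flag k -> exists2 w, w \in flag k & T w = v.
Proof.
elim/flag_ind: k => [k nk _ v|k kn IH neq v].
  by rewrite flag_out // memv0 => /eqP->; exists 0; rewrite ?mem0v // linear0.
move=> /flag_decomp[c [v' [Vv' ->]]].
have neqk: lam k != 0 by rewrite neq ?leqnn.
have [||w Vw eqw] := IH _ (v' - (c / lam k) *: (T (b k) - lam k *: b k)).
- by move=> j /andP[kj jn]; rewrite neq // jn ltnW.
- by rewrite memvB ?memvZ ?T_flag.
exists ((c / lam k) *: b k + w).
  by rewrite memvD ?memvZ ?mem_flag_b ?(mem_flagS Vw).
by rewrite linearD linearZ /= eqw -{3}(divfK neqk c); lmod_ring.
Qed.

Lemma flag_inj k v :
  (forall j, (k <= j < n)%N -> lam j != 0) -> v \in flag k -> T v = 0 -> v = 0.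
Proof.
elim/flag_ind: k v => [k nk v _|k kn IH v neq].
  by rewrite flag_out // memv0 => /eqP.
move=> /flag_decomp[c [w [Vw ->]]] Tv.
have/(flag_indep kn)/eqP: (lam k * c) *: b k \in flag k.+1.
  have -> : (lam k * c) *: b k
         = T (c *: b k + w) - T w - c *: (T (b k) - lam k *: b k).
    by rewrite linearD linearZ /=; lmod_ring.
  by rewrite Tv sub0r memvB ?memvN ?memvZ ?T_flag ?flag_stable.
rewrite mulf_eq0 (negPf (neq _ _)) ?leqnn //= => /eqP c0.
move: Tv; rewrite c0 scale0r add0r => Tw.
by apply: IH Tw => // j /andP[kj jn]; rewrite neq // jn ltnW.
Qed.

End Triangular.

Section Eigen.
Variables (T : {linear L -> L}) (lam : nat -> K).
Hypothesis T_flag : forall k, (k < n)%N -> T (b k) - lam k *: b k \in flag k.+1.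

Let shift_flag mu k : (k < n)%N ->
  (T \- mu \*: idfun) (b k) - (lam k - mu) *: b k \in flag k.+1.
Proof.
by move=> /T_flag/memv_cast; apply; rewrite /=; lmod_ring.
Qed.

(** The correction [w] to [b k] solves [T w - lam k *: w = lam k *: b k - T b k] in [flag k.+1],
    where the shifted diagonal has no zero. *)
Lemma flag_eigenvector k :
  (k < n)%N -> (forall j, (k < j < n)%N -> lam j != lam k) ->
  exists2 f, f - b k \in flag k.+1 & T f = lam k *: f.
Proof.
move=> kn neq; have Vr: lam k *: b k - T (b k) \in flag k.+1.
  by rewrite -opprB memvN T_flag.
have [|w Vw /= eqw] := flag_surj (shift_flag (lam k)) _ Vr.
  by move=> j /neq; rewrite subr_eq0.
exists (b k + w); first by rewrite addrC addKr.
by rewrite linearD scalerDr -(subrK (lam k *: w) (T w)) eqw; lmod_ring.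
Qed.

Lemma flag_eigen0 mu k v :
  (forall j, (k <= j < n)%N -> lam j != mu) -> v \in flag k -> T v = mu *: v ->
  v = 0.
Proof.
move=> neq Vv Tv; apply: (flag_inj (shift_flag mu) _ Vv).
  by move=> j /neq; rewrite subr_eq0.
by rewrite /= Tv subrr.
Qed.

(** On the leading coefficient at a position [m < k], the operator [T - lam k] acts as the nonzero
    factor [lam m - lam k], so these coefficients vanish one after another. *)
Lemma flag_eigen_mem k v : (k <= n)%N ->
  (forall j, (j < k)%N -> lam j != lam k) ->
  v \in flag 0 -> T v = lam k *: v -> v \in flag k.
Proof.
move=> kn neq V0v Tv; suff: forall m, (m <= k)%N -> v \in flag m by apply.
elim=> // m IH mk; have /flag_decomp[c [w [Vw ev]]] := IH (ltnW mk).
have mn: (m < n)%N := leq_trans mk kn.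
have/(flag_indep mn)/eqP: ((lam m - lam k) * c) *: b m \in flag m.+1.
  have -> : ((lam m - lam k) * c) *: b m
         = T v - lam k *: v - (T w - lam k *: w) - c *: (T (b m) - lam m *: b m).
    by rewrite ev linearD linearZ /=; lmod_ring.
  rewrite Tv subrr sub0r memvB ?memvN ?memvZ ?T_flag //.
  by rewrite memvB ?memvZ // (flag_stable T_flag).
rewrite mulf_eq0 subr_eq0 (negPf (neq _ _)) //= => /eqP c0.
by rewrite ev c0 scale0r add0r.
Qed.

Lemma flag_eigen_line k f v : (k < n)%N ->
  (forall j, (j < n)%N -> j != k -> lam j != lam k) ->
  f - b k \in flag k.+1 -> T f = lam k *: f ->
  v \in flag 0 -> T v = lam k *: v -> exists c, v = c *: f.
Proof.
move=> kn neq Vf Tf Vv Tv.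
have: v \in flag k.
  apply: flag_eigen_mem => // [|j jk]; first exact: ltnW.
  by rewrite neq ?(ltn_trans jk) // ltn_eqF.
(* Now [v - c *: f] is an eigenvector in [flag k.+1], where [lam k] no longer occurs on the
   diagonal. *)
move=> /flag_decomp[c [w [Vw ev]]]; exists c; apply/eqP; rewrite -subr_eq0.
apply/eqP/(@flag_eigen0 (lam k) k.+1).
- by move=> j /andP[kj jn]; rewrite neq // gtn_eqF.
- have -> : v - c *: f = w - c *: (f - b k) by rewrite ev; lmod_ring.
  by rewrite memvB ?memvZ.
- by rewrite linearB linearZ /= Tv Tf; lmod_ring.
Qed.

End Eigen.
End Flag.

(** * Algebras given by structure constants *)

Section Tables.
Variables (K : fieldType).

Lemma table_bracket_ebas m (t : nat -> nat -> 'rV[K]_m) i j :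
  (0 < i <= m)%N -> (0 < j <= m)%N ->
  table_bracket t (ebas K m i) (ebas K m j) = t i j.
Proof.
case: i j => [|i] // [|j] // im jm; rewrite /table_bracket.
rewrite (bigD1 (Ordinal im)) //= (bigD1 (Ordinal jm)) //= !mxE /= !eqxx mulr1.
rewrite scale1r [X in _ + X]big1 ?addr0 => [|k].
  rewrite big1 ?addr0 // => k.
  by rewrite -val_eqE /= => ki; rewrite !mxE /= eqSS (negPf ki) mulr0 scale0r.
rewrite -val_eqE /= => ki; rewrite big1 // => l _.
by rewrite !mxE eqSS (negPf ki) mul0r scale0r.
Qed.

Lemma ebas_out m i : (i == 0)%N || (m < i)%N -> ebas K m i = 0.
Proof.
move=> im; apply/rowP=> j; rewrite !mxE; case: eqP => // eij.
by move: im; rewrite -eij /= ltnNge ltn_ord.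
Qed.

Variable L : vectType K.

Definition lincomb m (F : nat -> L) (v : 'rV[K]_m) : L :=
  \sum_(k < m) v 0 k *: F k.+1.

Lemma lincomb_is_linear m F : linear (@lincomb m F).
Proof.
move=> a u v; rewrite /lincomb scaler_sumr -big_split; apply: eq_bigr => k _.
by rewrite !mxE scalerDl scalerA.
Qed.

HB.instance Definition _ m F :=
  GRing.isLinear.Build K 'rV[K]_m L _ (@lincomb m F) (lincomb_is_linear F).

Lemma lincomb_ebas m F i : (0 < i <= m)%N -> lincomb F (ebas K m i) = F i.
Proof.
case: i => // i im; rewrite /lincomb (bigD1 (Ordinal im)) //= !mxE eqxx scale1r.
rewrite big1 ?addr0 // => k; rewrite -val_eqE /= => ki.
by rewrite !mxE eqSS (negPf ki) scale0r.
Qed.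

Lemma row_ebas m (v : 'rV[K]_m) : v = \sum_(k < m) v 0 k *: ebas K m k.+1.
Proof.
apply/rowP=> j; rewrite summxE (bigD1 j) //= !mxE eqxx mulr1 big1 ?addr0 // => k.
by rewrite -val_eqE /= eq_sym => kj; rewrite !mxE eqSS (negPf kj) mulr0.
Qed.

(** A spanning family of [m = \dim L] vectors is a basis by rank-nullity, and the bracket is
    determined by its values on a basis. *)
Lemma table_isomorphic (br : {bilinear L -> L -> L}) m
    (t : nat -> nat -> 'rV[K]_m) (F : nat -> L) :
  \dim {:L} = m ->
  (forall U : {vspace L}, (forall i, (0 < i <= m)%N -> F i \in U) -> U = fullv) ->
  (forall i j, (0 < i <= m)%N -> (0 < j <= m)%N ->
     br (F i) (F j) = lincomb F (t i j)) ->
  isomorphic_onto (table_bracket t) br {:L}.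
Proof.
move=> dimL spanF brF; pose f : 'Hom('rV[K]_m, L) := linfun (lincomb F).
have fE v : f v = lincomb F v by rewrite lfunE.
have imf: limg f = fullv.
  apply: spanF => i im; rewrite -(lincomb_ebas F im) -fE; exact: memv_img (memvf _).
exists f; split=> //.
  have := limg_ker_dim f fullv; rewrite imf dimL capfv dimvf /dim /= mul1n.
  by rewrite -[in RHS](add0n m) => /addIn/eqP; rewrite dimv_eq0 => /eqP.
move=> x y; rewrite !fE /table_bracket linear_sum /= {2 3}/lincomb bracket_suml.
apply: eq_bigr => i _; rewrite linear_sum bracketZl bracket_sumr scaler_sumr.
apply: eq_bigr => j _.
by rewrite linearZ bracketZr scalerA brF /= ?ltn_ord.
Qed.

End Tables.

(** * Triangular bases of the algebra M^{1,0} *)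

(* The order e_1, e_2, e_n, e_3, ..., e_(n-1), then 0, in which the derivations
   of M^{1,0} are triangular, as values of i for e_i = ebas n i. *)
Definition M10_index n k : nat :=
  if (k < 2)%N then k.+1 else if (k == 2)%N then n else if (k < n)%N then k else 0%N.

(* Right multiplication by e_1 sends the k-th vector of that order to the
   M10_shift n k-th. *)
Definition M10_shift n k : nat :=
  if (k < 2)%N then k.+2 else if (k == 2)%N then n else k.+1.

(** The family is continued by zero from index [n] on, so the vanishing products of e_n and e_(n-1)
    with e_1, for which [M10_shift] returns [n], obey the same formula as the others. *)
Record M10_basis (K : fieldType) (L : vectType K) (br : {bilinear L -> L -> L})
    (n : nat) (b : nat -> L) : Prop := M10Basis {
  M10_out : forall k, (n <= k)%N -> b k = 0;
  M10_free : free [seq b j | j <- iota 0 n];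
  M10_mul0 : forall k, br (b k) (b 0%N) = b (M10_shift n k);
  M10_mulS : forall k j, br (b k) (b j.+1) = 0 }.

Lemma M10_table_index (K : fieldType) n m k : (4 <= n)%N -> (n <= m)%N ->
  (k < n)%N ->
  M10_table K n m (M10_index n k) 1 = ebas K m (M10_index n (M10_shift n k)).
Proof.
move=> hn nm kn; rewrite /M10_table /M10_index /M10_shift andbT.
case: k kn => [|[|[|k]]] kn //=.
- by rewrite hn; have -> : (1 < n - 2)%N by lia.
- have -> : (n == 1)%N = false by lia.
  have -> : (1 < n <= n - 2)%N = false by lia.
  rewrite /= (_ : (n < 2)%N = false); last by lia.
  by rewrite (_ : (n == 2)%N = false) ?ltnn ?ebas_out //; lia.
- rewrite kn /= andbT; have [kn'|nk] := ltnP k.+4 n.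
    by have -> : (k.+3 <= n - 2)%N by lia.
  have -> : (k.+3 <= n - 2)%N = false by lia.
  by rewrite ebas_out.
Qed.

Lemma exists_M10_basis (K : fieldType) (L : vectType K)
    (br : {bilinear L -> L -> L}) n (N : {vspace L}) :
  (4 <= n)%N -> isomorphic_onto (@M10_bracket K n) br N ->
  exists2 b, M10_basis br n b & flag n b 0 = N.
Proof.
move=> hn [f [kf imf fM]].
pose b k := f (ebas K n (M10_index n k)).
have idx_gt0 k : (k < n)%N -> (0 < M10_index n k <= n)%N.
  by rewrite /M10_index; case: k => [|[|[|k]]] //= kn; rewrite ?kn; lia.
have b_out k : (n <= k)%N -> b k = 0.
  move=> nk; rewrite /b ebas_out ?linear0 // /M10_index.
  by rewrite !ifN //; lia.
have dimN : \dim N = n.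
  by have := limg_ker_dim f fullv; rewrite kf capv0 dimv0 imf dimvf /dim /= mul1n.
have flagN : flag n b 0 = N.
  apply/eqP; rewrite eqEsubv; apply/andP; split.
    by apply/span_subvP=> _ /mapP[k _ ->]; rewrite -imf memv_img ?memvf.
  rewrite -imf; apply/subvP=> _ /memv_imgP[v _ ->].
  rewrite (row_ebas v) linear_sum memv_suml // => i _; rewrite linearZ memvZ //.
  have [k kn eik] : exists2 k, (k < n)%N & i.+1 = M10_index n k.
    rewrite /M10_index; have [i2|i2] := ltnP i.+1 3.
      by exists i => //; case: i i2 => [[|[|]]].
    have [ein|nin] := eqVneq i.+1 n; first by exists 2%N; rewrite //; lia.
    exists i.+1; first by rewrite ltn_neqAle nin ltn_ord.
    rewrite ifN -?leqNgt ?(ltnW i2) // ifN ?ifT ?gtn_eqF //.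
    by rewrite ltn_neqAle nin ltn_ord.
  rewrite eik -/(b k) memv_span //.
  by apply: (@map_f _ _ b); rewrite mem_iota subn0.
exists b => //; split=> //.
- have := dimN; rewrite -flagN /flag subn0 /free => ->.
  by rewrite size_map size_iota.
- move=> k; have [kn|nk] := ltnP k n.
    rewrite /b -fM /M10_bracket table_bracket_ebas ?idx_gt0 ?M10_table_index //.
    by rewrite (leq_trans _ hn).
  rewrite b_out // linear0l b_out // /M10_shift.
  by rewrite !ifN //; lia.
- move=> k j; have [kn|nk] := ltnP k n; last by rewrite b_out // linear0l.
  have [jn|nj] := ltnP j.+1 n; last by rewrite (b_out _ nj) linear0r.
  rewrite /b -fM /M10_bracket table_bracket_ebas ?idx_gt0 // /M10_table.
  have -> : (M10_index n j.+1 == 1)%N = false.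
    by rewrite /M10_index; case: j jn => [|[|j]] //= jn; rewrite ?jn; lia.
  by rewrite !andbF linear0.
Qed.

(** * Weights of right multiplications on the nilradical *)

(* The eigenvalues of a derivation of M^{1,0} with eigenvalue w_0 on e_1 and
   w_1 on e_2, in the order of M10_index. *)
Definition M10_weight (K : fieldType) (w : 'rV[K]_2) k : K :=
  if k == 0%N then w 0 0 else if k == 1%N then w 0 1
  else if k == 2%N then w 0 0 *+ 2 else w 0 1 + w 0 0 *+ (k - 2).

(** The leading coefficient is chosen here as a linear form, which will make the weights linear in
    the acting element. *)
Lemma flag_coord (K : fieldType) (L : vectType K) n (b : nat -> L) :
  (forall k, (n <= k)%N -> b k = 0) -> free [seq b j | j <- iota 0 n] ->
  forall k, (k < n)%N -> exists c : {linear L -> K | *%R},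
    forall v, v \in flag n b k -> v - c v *: b k \in flag n b k.+1.
Proof.
move=> b_out b_free k kn.
have sz: size [seq b j | j <- iota 0 n] == n by rewrite size_map size_iota.
pose X := Tuple sz; exists (coord X (Ordinal kn)) => v.
have nthX j (jn : (j < n)%N) : X`_(Ordinal jn) = b j.
  by rewrite (nth_map 0%N) ?size_iota // nth_iota.
have coord0 m w : (k < m)%N -> w \in flag n b m -> coord X (Ordinal kn) w = 0.
  elim/(@flag_ind n): m w => [m nm w _|m mn IH w km].
    by rewrite (flag_out b nm) memv0 => /eqP->; rewrite linear0.
  move=> /(flag_decomp b_out)[c [w' [Vw' ->]]].
  rewrite linearD linearZ /= (IH _ (leqW km) Vw') addr0 -(nthX m mn).
  by rewrite coord_free // -val_eqE /= gtn_eqF // mulr0.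
move=> /(flag_decomp b_out)[c [w [Vw ->]]].
rewrite /=; have -> : coord X (Ordinal kn) (c *: b k + w) = c.
  rewrite linearD linearZ /= (coord0 k.+1 w) // addr0 -(nthX k kn) coord_free //.
  by rewrite eqxx mulr1.
by rewrite addrAC subrr add0r.
Qed.

Section Weights.
Variables (K : fieldType) (L : vectType K) (br : {bilinear L -> L -> L}).
Variables (n : nat) (b : nat -> L).
Hypothesis bM : M10_basis br n b.

Let b_out := M10_out bM.

Lemma flag_bracketP k x (U : {vspace L}) :
  (forall j, (k <= j < n)%N -> br (b j) x \in U) ->
  forall v, v \in flag n b k -> br v x \in U.
Proof.
elim/(@flag_ind n): k => [k nk _ v|k kn IH HU v].
  by rewrite (flag_out b nk) memv0 => /eqP->; rewrite linear0l mem0v.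
move=> /(flag_decomp b_out)[c [w [Vw ->]]].
rewrite bracketDl bracketZl memvD ?memvZ ?HU ?leqnn // IH // => j /andP[kj jn].
by rewrite HU // jn ltnW.
Qed.

Lemma flag_bracket_shift k m :
  (forall j, (k <= j < n)%N -> (m <= M10_shift n j)%N) ->
  forall v, v \in flag n b k -> br v (b 0) \in flag n b m.
Proof.
move=> km; apply: flag_bracketP => j kj.
by rewrite (M10_mul0 bM) (mem_flag_b b_out) ?km.
Qed.

Lemma flag_bracket_r v w : v \in flag n b 0 -> w \in flag n b 1 -> br v w = 0.
Proof.
move=> Vv Vw; apply/eqP; rewrite -memv0; move: v Vv; apply: flag_bracketP => j _.
rewrite memv0; move: w Vw; suff H k w : w \in flag n b k.+1 -> br (b j) w == 0.
  exact: H.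
have [m] := ubnP (n - k)%N; elim: m k w => // m IH k w nkm.
have [kn|nk] := ltnP k.+1 n; last first.
  by rewrite (flag_out b nk) memv0 => /eqP->; rewrite linear0r.
move=> /(flag_decomp b_out)[c [w' [Vw' ->]]].
rewrite bracketDr bracketZr (M10_mulS bM) scaler0 add0r.
by apply: IH Vw'; lia.
Qed.

Hypothesis hn : (4 <= n)%N.

Lemma M10_shift_gt k : (k < n)%N -> (k < M10_shift n k)%N.
Proof. by rewrite /M10_shift; case: k => [|[|[|k]]]. Qed.

Lemma flag_bracketS k v : v \in flag n b k -> br v (b 0) \in flag n b k.+1.
Proof.
apply: flag_bracket_shift => j /andP[kj jn].
exact: leq_ltn_trans kj (M10_shift_gt jn).
Qed.

(** The first vectors move by two positions, [b 0] to [b 2] and [b 1] to [b 3], so remainders must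
    be controlled one step better than by [flag_bracketS]. *)
Lemma flag_bracket1 v : v \in flag n b 1 -> br v (b 0) \in flag n b 3.
Proof.
apply: flag_bracket_shift => j; rewrite /M10_shift.
by case: j => [|[|[|j]]] //= _; lia.
Qed.

Lemma flag_bracket2 v : v \in flag n b 2 -> br v (b 0) \in flag n b 4.
Proof.
by apply: flag_bracket_shift => j; rewrite /M10_shift; case: j => [|[|[|j]]].
Qed.

Hypotheses (hLeibniz : leibniz_identity br) (idN : ideal br (flag n b 0)).

Lemma bracket_derivation x y z :
  br (br x y) z = br x (br y z) + br (br x z) y.
Proof. by rewrite hLeibniz subrK. Qed.

(** Since [br (b k)] kills [flag 1], the derivation rule shows that multiplying [b k] by [b 0] adds
    [a] to its weight and multiplies its remainder by [b 0]. All weights follow from the first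
    two. *)
Lemma M10_weights_of y a d :
  br (b 0) y - a *: b 0 \in flag n b 1 -> br (b 1) y - d *: b 1 \in flag n b 2 ->
  forall k, (k < n)%N ->
    br (b k) y - M10_weight (\row_j [:: a; d]`_j) k *: b k \in flag n b k.+1.
Proof.
set w := \row_j _; set r0 := br (b 0) y - _; set r1 := br (b 1) y - _.
move=> Vr0 Vr1.
have Db0 : br (b 0) y = a *: b 0 + r0 by rewrite /r0 addrC subrK.
have Db1 : br (b 1) y = d *: b 1 + r1 by rewrite /r1 addrC subrK.
have w0 : M10_weight w 0 = a by rewrite /M10_weight !mxE.
have w1 : M10_weight w 1 = d by rewrite /M10_weight !mxE.
have Vb k : b k \in flag n b 0 by apply: mem_flag_b.
have step k l : M10_shift n k = l ->
    br (b l) y - (a + M10_weight w k) *: b l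
    = br (br (b k) y - M10_weight w k *: b k) (b 0).
  move=> kl; rewrite -kl -(M10_mul0 bM) bracket_derivation Db0.
  rewrite bracketDr (flag_bracket_r (Vb k) Vr0) addr0 bracketZr.
  rewrite [RHS]bracketBl [in RHS]bracketZl.
  by move: (M10_weight w k) => c; lmod_ring.
case=> [|[|k]] kn; first by rewrite w0.
  by rewrite w1.
elim: k kn => [|k IH] kn.
  have -> : M10_weight w 2 = a + M10_weight w 0.
    by rewrite w0 /M10_weight /= mxE mulr2n.
  by rewrite (step 0%N) // w0 flag_bracket1.
(* The vector [b 3] comes from [b 1], not from [b 2], which ends the chain of [b 0]. *)
have [k0|k0] := posnP k.
  rewrite {}k0 in kn *; have -> : M10_weight w 3 = a + M10_weight w 1.
    by rewrite w1 /M10_weight /= !mxE addrC.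
  by rewrite (step 1%N) // w1 flag_bracket2.
case: k k0 IH kn => // k _ IH kn.
have -> : M10_weight w k.+4 = a + M10_weight w k.+3.
  by rewrite /M10_weight /= !mxE /= !subn2 /= mulrS addrCA.
by rewrite (step k.+3) // flag_bracketS // IH // ltnW.
Qed.

(** Let [c] be the coefficient of [b 0] in [br (b 1) y]. Differentiating [br (b 1) (b 1) = 0] leaves
    [c *: b 3 = 0], and [b 3] is nonzero because [4 <= n]. *)
Lemma bracket_b1_flag y : br (b 1) y \in flag n b 1.
Proof.
have Vb k : b k \in flag n b 0 by apply: mem_flag_b.
have [/(flag_decomp b_out)[c [v [Vv e]]] _] := idN y (Vb 1%N).
have Vb1 : b 1%N \in flag n b 1 by apply: mem_flag_b.
have vb1 : br v (b 1) = 0 by rewrite flag_bracket_r // mem_flagS.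
have: br (br (b 1) (b 1)) y = c *: b 3.
  rewrite bracket_derivation e bracketDr bracketZr (M10_mul0 bM).
  rewrite (flag_bracket_r (Vb _) Vv) addr0 bracketDl bracketZl !(M10_mulS bM).
  by rewrite scaler0 add0r vb1 addr0.
rewrite (M10_mulS bM) linear0l => c0.
have c00 : c = 0 by apply: (flag_indep (M10_free bM) hn); rewrite -c0 mem0v.
by rewrite e c00 scale0r add0r.
Qed.

Lemma exists_M10_weights : exists phi : 'Hom(L, 'rV[K]_2), forall y k,
  (k < n)%N -> br (b k) y - M10_weight (phi y) k *: b k \in flag n b k.+1.
Proof.
have Vb k : b k \in flag n b 0 by apply: mem_flag_b.
have n0 : (0 < n)%N by apply: leq_trans hn.
have n1 : (1 < n)%N by apply: leq_trans hn.
have [c0 c0P] := flag_coord b_out (M10_free bM) n0.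
have [c1 c1P] := flag_coord b_out (M10_free bM) n1.
pose f y : 'rV[K]_2 := \row_j [:: c0 (br (b 0) y); c1 (br (b 1) y)]`_j.
have f_lin : linear f.
  move=> a u v; apply/rowP=> j; rewrite !mxE.
  by case: j => [[|[|]]] //= _; rewrite bracketDr bracketZr linearD linearZ.
pose F : {linear L -> 'rV[K]_2} := HB.pack f (GRing.isLinear.Build K L _ _ f f_lin).
exists (linfun F) => y k kn; rewrite lfunE /= /f.
apply: M10_weights_of => //; first by apply: c0P; have [] := idN y (Vb 0%N).
exact/c1P/bracket_b1_flag.
Qed.

End Weights.

(** * The common kernel of the weights is the nilradical *)

Section Radical.
Variables (K : fieldType) (L : vectType K) (br : {bilinear L -> L -> L}).
Variables (n : nat) (b : nat -> L) (phi : 'Hom(L, 'rV[K]_2)).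
Hypotheses (hLeibniz : leibniz_identity br) (hn : (4 <= n)%N).
Hypotheses (bM : M10_basis br n b) (nilN : nilradical br (flag n b 0)).
Hypotheses (hdim : \dim {:L} = (n + 2)%N) (hsolv : solvable br {:L}).
Hypothesis phiP : forall y k, (k < n)%N ->
  br (b k) y - M10_weight (phi y) k *: b k \in flag n b k.+1.

Let b_out := M10_out bM.
Let b_free := M10_free bM.
Let idN : ideal br (flag n b 0). Proof. by case: nilN. Qed.

Lemma M10_weight_unique y k c : (k < n)%N ->
  br (b k) y - c *: b k \in flag n b k.+1 -> M10_weight (phi y) k = c.
Proof.
move=> kn Vc; apply/eqP; rewrite -subr_eq0; apply/eqP/(flag_indep b_free kn).
apply: (memv_cast (memvB Vc (phiP y kn))).
by move: (M10_weight _ _) => d; lmod_ring.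
Qed.

Lemma M10_weight0 k : M10_weight (0 : 'rV[K]_2) k = 0.
Proof. by rewrite /M10_weight !mxE !mul0rn addr0 !if_same. Qed.

Lemma phi_eq0 y :
  (forall k, (k < n)%N -> br (b k) y \in flag n b k.+1) -> phi y = 0.
Proof.
move=> Vy; have w0 k : (k < n)%N -> M10_weight (phi y) k = 0.
  by move=> kn; apply: M10_weight_unique => //; rewrite scale0r subr0 Vy.
have e0 := w0 _ (leq_trans (isT : (0 < 4)%N) hn).
have e1 := w0 _ (leq_trans (isT : (1 < 4)%N) hn).
apply/rowP=> j; rewrite mxE; case: j => [[|[|]]] //= jP.
  by rewrite -[RHS]e0; congr (phi y _ _); apply: val_inj.
by rewrite -[RHS]e1; congr (phi y _ _); apply: val_inj.
Qed.

Lemma flag_right_stable y k v : v \in flag n b k -> br v y \in flag n b k.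
Proof. exact: (flag_stable b_out (T := applyr br y) (phiP y)). Qed.

(** By the Leibniz identity, right multiplication by [br y z] is a commutator of triangular
    operators; the two composites have the same diagonal. *)
Lemma phi_bracket y z : phi (br y z) = 0.
Proof.
apply: phi_eq0 => k kn; rewrite hLeibniz.
have prod u v : br (br (b k) u) v
    - (M10_weight (phi u) k * M10_weight (phi v) k) *: b k \in flag n b k.+1.
  apply: (memv_cast (memvD (memvZ (M10_weight (phi u) k) (phiP v kn))
                           (flag_right_stable v (phiP u kn)))).
  rewrite bracketBl bracketZl.
  by move: (M10_weight _ _) (M10_weight _ _) => c d; lmod_ring.
apply: (memv_cast (memvB (prod y z) (prod z y))).
by move: (M10_weight _ _) (M10_weight _ _) => c d; lmod_ring.
Qed.

(** Only the [b 0] component acts from the right on the nilradical, and it moves the flag strictly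
    down. *)
Lemma phi_nilradical y : y \in flag n b 0 -> phi y = 0.
Proof.
move=> /(flag_decomp b_out)[c [v [Vv ->]]]; apply: phi_eq0 => k kn.
rewrite bracketDr bracketZr (flag_bracket_r bM (mem_flag_b b_out _) Vv) //.
by rewrite addr0 memvZ // (flag_bracketS bM) // (mem_flag_b b_out).
Qed.

Lemma sub_nilradical (I : {vspace L}) :
  ideal br I -> (flag n b 0 <= I)%VS -> (I <= lker phi)%VS ->
  (brv br I I <= flag n b 0)%VS -> (I <= flag n b 0)%VS.
Proof.
(* The first bracket enters [flag n b 0]; each of the next [n] descends one step, because elements
   of [I] have zero weights. *)
move=> idI sNI sIk sII; have [_ _] := nilN; apply=> //; exists n.+1.
have strict k y v : y \in I -> v \in flag n b k -> br v y \in flag n b k.+1.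
  move=> Iy; apply: (flag_bracketP bM) => j /andP[kj jn].
  apply: (mem_flag_le b_out) (_ : (k < j.+1)%N) _ => //.
  have := phiP y jn; rewrite (_ : phi y = 0) ?M10_weight0 ?scale0r ?subr0 //.
  by apply/eqP; rewrite -memv_ker (subvP sIk).
suff lcs k : (lower_central_series br I k.+1 <= flag n b k)%VS.
  by apply/eqP; rewrite -subv0 -(flag_out b (leqnn n)).
elim: k => [|k IH]; first exact: sII.
by apply/brvP=> u v /(subvP IH) Vu Iv; apply: strict.
Qed.

Lemma dim_nilradical : \dim (flag n b 0) = n.
Proof.
have := b_free; rewrite /free /flag subn0 => /eqP->.
by rewrite size_map size_iota.
Qed.

Lemma bracket_nilradical x y : br x y \in flag n b 0.
Proof.
pose I := (brv br fullv fullv + flag n b 0)%VS.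
have sL2I: (brv br fullv fullv <= I)%VS by rewrite addvSl.
have sNI: (flag n b 0 <= I)%VS by rewrite addvSr.
have inI u v : br u v \in I by rewrite (subvP sL2I) // memv_brv ?memvf.
have sIk: (I <= lker phi)%VS.
  rewrite subv_add; apply/andP; split.
    by apply/brvP=> u v _ _; rewrite memv_ker phi_bracket.
  by apply/subvP=> v Vv; rewrite memv_ker phi_nilradical.
suff sIN: (I <= flag n b 0)%VS by rewrite (subvP sIN).
(* If [I] were all of [L], solvability would force [L] into the nilradical, whose dimension is only
   [n]. *)
have dimI: (\dim I <= n.+1)%N.
  have [sLI|nLI] := boolP (fullv <= I)%VS.
    have := dimvS (solvable_sub_brv hsolv idN sLI).
    by rewrite hdim dim_nilradical; lia.
  have := dimv_leqif_sup (subvf I) => -[le_dim eq_dim].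
  by move: eq_dim; rewrite (negPf nLI) => /negbT; move: le_dim; rewrite hdim; lia.
pose I' := (brv br I I + flag n b 0)%VS.
have sI'I: (I' <= I)%VS.
  by rewrite subv_add sNI andbT; apply/brvP=> u v _ _; apply: inI.
(* Either [I' = I], and solvability concludes, or the dimension drops to [n] and [I'] is the
   nilradical, so that the square of [I] lies in it. *)
have [sII'|nII'] := boolP (I <= I')%VS; first exact: solvable_sub_brv sII'.
have dimI': (\dim I' <= n)%N.
  have := dimv_leqif_sup sI'I => -[le_dim eq_dim].
  by move: eq_dim; rewrite (negPf nII') => /negbT; lia.
have sI'N: (I' <= flag n b 0)%VS.
  have := dimv_leqif_sup (addvSr (brv br I I) (flag n b 0)) => -[le_dim <-].
  by rewrite -/I' dim_nilradical eqn_leq -{1}dim_nilradical le_dim.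
apply: sub_nilradical => //.
exact: subv_trans (addvSl _ _) sI'N.
Qed.

Lemma lker_phi : (lker phi <= flag n b 0)%VS.
Proof.
apply: sub_nilradical => //.
- by move=> u v _; rewrite !memv_ker !phi_bracket eqxx.
- by apply/subvP=> v Vv; rewrite memv_ker phi_nilradical.
- by apply/brvP=> u v _ _; apply: bracket_nilradical.
Qed.

(** The kernel is the nilradical, of codimension 2, so the rank is 2. *)
Lemma phi_surj w : exists x, phi x = w.
Proof.
suff sf: (fullv <= limg phi)%VS.
  by have /memv_imgP[x _ ->] := subvP sf w (memvf w); exists x.
have := dimv_leqif_sup (subvf (limg phi)) => -[_ <-].
have := limg_ker_dim phi fullv; rewrite capfv hdim dimvf /dim /= mul1n.
have -> : lker phi = flag n b 0.
  apply/eqP; rewrite eqEsubv lker_phi; apply/subvP=> v Vv.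
  by rewrite memv_ker phi_nilradical.
by rewrite dim_nilradical => /addnI->.
Qed.

End Radical.

(** * An abelian complement and an eigenbasis of the nilradical *)

Section Torus.
Variables (K : fieldType) (L : vectType K) (br : {bilinear L -> L -> L}).
Variables (n : nat) (b : nat -> L) (phi : 'Hom(L, 'rV[K]_2)) (h : L).
Hypotheses (hLeibniz : leibniz_identity br) (hn : (4 <= n)%N).
Hypothesis natr_inj : injective (fun i : nat => i%:R : K).
Hypothesis bM : M10_basis br n b.
Hypothesis phiP : forall y k, (k < n)%N ->
  br (b k) y - M10_weight (phi y) k *: b k \in flag n b k.+1.
Hypothesis bracketN : forall x y, br x y \in flag n b 0.
(* With these eigenvalues on e_1 and e_2, the n eigenvalues of the right
   multiplication by h on the nilradical are distinct and nonzero. *)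
Hypothesis phi_h : phi h = \row_j [:: 1; n%:R]`_j.

Let b_out := M10_out bM.
Let b_free := M10_free bM.

(** In the order of [b] the values are 1, n, 2, n + 1, n + 2, and so on; as natural numbers they are
    compared by [lia]. *)
Definition M10_hweight k : nat :=
  if k == 0%N then 1 else if k == 2%N then 2 else (n + k - (1 < k) - (0 < k))%N.

Lemma weight_h k : M10_weight (phi h) k = (M10_hweight k)%:R.
Proof.
rewrite /M10_weight phi_h !mxE /M10_hweight.
case: k => [|[|[|k]]] //=; rewrite -?natrD; congr _%:R; lia.
Qed.

Lemma weight_h_eq k m : (M10_weight (phi h) k == m%:R) = (M10_hweight k == m).
Proof. by rewrite weight_h (inj_eq natr_inj). Qed.

Lemma weight_h_neq0 k : (0 <= k < n)%N -> M10_weight (phi h) k != 0.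
Proof.
rewrite -(mulr0n 1) weight_h_eq /M10_hweight => kn.
by case: k kn => [|[|[|k]]] //= kn; lia.
Qed.

Let h_flag := phiP h.

Lemma torus_eigen0 (mu : nat) v : (forall k, (k < n)%N -> M10_hweight k != mu) ->
  v \in flag n b 0 -> br v h = mu%:R *: v -> v = 0.
Proof.
move=> neq Vv; apply: (flag_eigen0 b_out b_free (T := applyr br h) h_flag _ Vv).
by move=> j /= jn; rewrite weight_h_eq neq.
Qed.

Lemma torus_eigenvector k : (k < 2)%N ->
  exists2 g, g - b k \in flag n b k.+1 & br g h = (M10_hweight k)%:R *: g.
Proof.
move=> k2; rewrite -weight_h.
apply: (flag_eigenvector b_out (T := applyr br h) h_flag); first by lia.
move=> j kj; rewrite (weight_h k) weight_h_eq /M10_hweight.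
by case: k k2 kj => [|[|]] // _; case: j => [|[|[|j]]] //= kj; lia.
Qed.

Lemma torus_eigen_line k g v : (k < 2)%N ->
  g - b k \in flag n b k.+1 -> br g h = (M10_hweight k)%:R *: g ->
  v \in flag n b 0 -> br v h = (M10_hweight k)%:R *: v -> exists c, v = c *: g.
Proof.
rewrite -weight_h => k2.
apply: (flag_eigen_line b_out b_free (T := applyr br h) h_flag); first by lia.
move=> j jn; rewrite (weight_h k) weight_h_eq /M10_hweight.
by case: k k2 => [|[|]] // _; case: j jn => [|[|[|j]]] //= jn; lia.
Qed.

(** Right multiplication by [h] is onto on the nilradical, which contains [br y h]; so [y] can be
    corrected by an element there, without changing [phi]. *)
Lemma exists_torus w : (exists y, phi y = w) ->
  exists2 x, phi x = w & br x h = 0.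
Proof.
move=> [y <-].
have [|z Vz zy] := flag_surj b_out (T := applyr br h) h_flag (k := 0%N) _
  (bracketN y h).
  exact: weight_h_neq0.
exists (y - z); last by rewrite bracketBl -zy subrr.
by rewrite linearB /= (phi_nilradical hn bM phiP Vz) subr0.
Qed.

(** The right-hand side of the Leibniz identity is skew in its last two arguments. *)
Lemma bracket_kerC x y z : br x (br y z) = - br x (br z y).
Proof. by rewrite !hLeibniz opprB. Qed.

(** By the derivation rule [br x y] is killed by right multiplication by [h], which is injective on
    the nilradical. *)
Lemma torus_abelian x y : br x h = 0 -> br y h = 0 -> br x y = 0.
Proof.
move=> xh yh; apply: (flag_inj b_out b_free (T := applyr br h) h_flag _ (bracketN x y)).
  exact: weight_h_neq0.
by rewrite /= bracket_derivation // xh yh linear0r linear0l addr0.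
Qed.

Lemma torus_commute x y : br x h = 0 -> br (br y h) x = br (br y x) h.
Proof.
move=> xh; apply/eqP; rewrite -subr_eq0 -hLeibniz bracket_kerC xh.
by rewrite linear0r oppr0.
Qed.

(** The products of [M10_basis] are imposed on new generators; at index 3 the recursion restarts
    from [g1], since index 2 holds the square of [g0]. *)
Fixpoint M10_chain (g0 g1 : L) k : L :=
  match k with
  | 0 => g0
  | 1 => g1
  | 2 => br g0 g0
  | k'.+1 => br (if k' == 2%N then g1 else M10_chain g0 g1 k') g0
  end.

Variables g0 g1 : L.
Hypotheses (g0P : g0 - b 0 \in flag n b 1) (g1P : g1 - b 1 \in flag n b 2).
Hypotheses (g0h : br g0 h = g0) (g1h : br g1 h = n%:R *: g1).

Let g := M10_chain g0 g1.

Lemma chain_mul0 k : (k != 2)%N -> br (g k) g0 = g (M10_shift n k).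
Proof. by case: k => [|[|[|[|k]]]]. Qed.

Lemma bracket_g0 v : v \in flag n b 0 -> br v g0 = br v (b 0).
Proof.
move=> Vv; rewrite -(subrK (b 0%N) g0) bracketDr.
by rewrite (flag_bracket_r bM Vv g0P) add0r.
Qed.

Lemma chain_unitri k : g k - b k \in flag n b k.+1.
Proof.
have mem0 j : g j - b j \in flag n b j.+1 -> g j \in flag n b 0.
  move=> /(mem_flag_le b_out (leq0n _)) Vj.
  by rewrite -(subrK (b j) (g j)) memvD ?(mem_flag_b b_out).
have step j : (j != 2)%N -> g j - b j \in flag n b j.+1 ->
    g (M10_shift n j) - b (M10_shift n j) = br (g j - b j) (b 0).
  move=> j2 Vj; rewrite -chain_mul0 // bracket_g0 ?mem0 // bracketBl.
  by rewrite (M10_mul0 bM).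
(* Two consecutive indices are carried along because [g 2] and [g 3] are built from [g 0] and
   [g 1]. *)
suff [] : g k - b k \in flag n b k.+1 /\ g k.+1 - b k.+1 \in flag n b k.+2 by [].
elim: k => [|k [IH IH1]]; first by split.
split=> //; case: k IH IH1 => [|[|k]] IH IH1.
- by rewrite (step 0%N) // (flag_bracket1 bM).
- by rewrite (step 1%N) // (flag_bracket2 bM).
by rewrite (step k.+3) // (flag_bracketS bM).
Qed.

Lemma chain_mem k : g k \in flag n b k.
Proof.
rewrite -(subrK (b k) (g k)) memvD ?(mem_flag_b b_out) //.
by rewrite (mem_flagS b_out) ?chain_unitri.
Qed.

Lemma chain_mem0 k : g k \in flag n b 0.
Proof. exact: mem_flag_le (leq0n k) (chain_mem k). Qed.

Lemma chain_out k : (n <= k)%N -> g k = 0.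
Proof. by move=> nk; have := chain_mem k; rewrite flag_out // memv0 => /eqP. Qed.

Lemma chain_indep k c : (k < n)%N -> c *: g k = 0 -> c = 0.
Proof.
move=> kn cg; apply: (flag_indep b_free kn).
have := memvZ (- c) (chain_unitri k).
by rewrite scalerBr scaleNr cg oppr0 sub0r scaleNr opprK.
Qed.

Lemma chain_mulS k j : br (g k) (g j.+1) = 0.
Proof.
apply: (flag_bracket_r bM (chain_mem0 k)).
exact: mem_flag_le (ltn0Sn j) (chain_mem _).
Qed.

(** This product would have eigenvalue 2 + 1 = 3 under [h], while the eigenvalues are 1, 2 and
    integers at least [n], hence at least 4. *)
Lemma chain2_mul0 : br (g 2) g0 = 0.
Proof.
have g2h : br (g 2) h = 2%:R *: g 2.
  by rewrite /g /= bracket_derivation // g0h; move: (br g0 g0) => u; lmod_ring.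
apply: (@torus_eigen0 3); last 1 first.
- rewrite bracket_derivation // g0h g2h bracketZl.
  by move: (br (g 2) g0) => u; lmod_ring.
- by case=> [|[|[|k]]] //=; rewrite /M10_hweight /=; lia.
- exact: bracketN.
Qed.

Lemma chain_mulE k : br (g k) (g 0) = g (M10_shift n k).
Proof.
have [->|k2] := eqVneq k 2%N; last exact: chain_mul0.
by rewrite chain2_mul0 chain_out.
Qed.

Section TorusElement.
Variable x : L.
Hypothesis xh : br x h = 0.
Let a := phi x 0 0.

Lemma chain_line k v : (k < 2)%N -> v \in flag n b 0 ->
  br v h = (M10_hweight k)%:R *: v -> exists c, v = c *: g k.
Proof.
move=> k2; apply: torus_eigen_line (chain_unitri k) _ => //.
by case: k k2 => [|[|]] //= _; rewrite /M10_hweight ?scale1r //= subn0 addnK.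
Qed.

(** Right multiplication by [x] commutes with that by [h], so it preserves the eigenlines of [g 0]
    and [g 1]; on the rest of the chain the weights add up by the derivation rule. *)
Lemma chain_weight k : br (g k) x = M10_weight (phi x) k *: g k.
Proof.
have base j : (j < 2)%N -> br (g j) h = (M10_hweight j)%:R *: g j ->
    br (g j) x = M10_weight (phi x) j *: g j.
  move=> j2 gh; have jn : (j < n)%N by lia.
  have [|c e] := chain_line j2 (bracketN (g j) x).
    by rewrite -torus_commute // gh bracketZl.
  rewrite e; congr (_ *: _); apply/esym.
  apply: (M10_weight_unique bM phiP jn).
  apply: (memv_cast (memvB (memvZ c (chain_unitri j))
    (flag_right_stable bM phiP x (chain_unitri j)))).
  by rewrite bracketBl e; lmod_ring.
have w0 : M10_weight (phi x) 0 = a by [].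
have b0 : br (g 0) x = a *: g 0.
  by rewrite base //= /M10_hweight scale1r.
have b1 : br (g 1) x = M10_weight (phi x) 1 *: g 1.
  by rewrite base //= /M10_hweight /= subn0 addnK.
have step j : br (g j) x = M10_weight (phi x) j *: g j ->
    br (br (g j) g0) x = (M10_weight (phi x) j + a) *: br (g j) g0.
  move=> e; rewrite bracket_derivation // b0 e bracketZr bracketZl.
  by rewrite addrC scalerDl.
elim: k => [|k IH]; first exact: b0.
case: k IH => [|[|[|k]]] IH; first exact: b1.
- by apply: etrans (step 0%N b0) _; rewrite w0 -mulr2n.
- exact: etrans (step 1%N b1) _.
by apply: etrans (step k.+3 IH) _; rewrite /M10_weight /= !subn2 -addrA -mulrSr.
Qed.

Lemma torus_chain0 : br x g0 = - a *: g0.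
Proof.
have [|c e] := chain_line (isT : (0 < 2)%N) (bracketN x g0).
  by rewrite bracket_derivation // g0h xh linear0l addr0 /M10_hweight scale1r.
rewrite e; congr (_ *: _); apply/eqP; rewrite -subr_eq0 opprK; apply/eqP.
apply: (@chain_indep 2); first by lia.
(* With [br x g0 = c *: g0], this identity reads [c *: g 2 = a *: g 2 - (2 * a) *: g 2]. *)
have := hLeibniz g0 x g0; rewrite e bracketZr.
rewrite (chain_weight 0) (chain_weight 2) bracketZl /M10_weight /= -/a.
move/eqP; rewrite -subr_eq0 => /eqP <-.
by rewrite mulr2n; lmod_ring.
Qed.

(** From index 3 on the chain consists of products [br (g j.+1) g0], killed by [skew] because the
    reversed products vanish; [g 2] is a square, and only [g 1] needs its eigenline. *)
Lemma torus_chainS k : br x (g k.+1) = 0.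
Proof.
have skew j : br x (br (g j.+1) g0) = 0.
  by rewrite bracket_kerC (chain_mulS 0 j) linear0r oppr0.
case: k => [|[|[|k]]]; last 1 first.
- exact: (skew k.+2).
- have [|c e] := chain_line (isT : (1 < 2)%N) (bracketN x (g 1)).
    rewrite bracket_derivation // xh linear0l addr0 g1h bracketZr.
    by rewrite /M10_hweight /= subn0 addnK.
  rewrite e (@chain_indep 3 c) ?scale0r //.
  (* The identity reduces to [c *: g 3 = 0]. *)
  have := hLeibniz x g0 g1; rewrite (chain_mulS 0 0) linear0r torus_chain0.
  rewrite bracketZl (chain_mulS 0 0) scaler0 sub0r e bracketZl => /esym/eqP.
  by rewrite oppr_eq0 => /eqP.
- by have := hLeibniz x g0 g0; rewrite subrr.
- exact: (skew 0%N).
Qed.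

End TorusElement.
End Torus.

(** * Comparison with the multiplication table *)

(* The inverse of M10_index on 1, ..., n. *)
Definition M10_pos n i : nat :=
  if (i <= 2)%N then i.-1 else if i == n then 2 else i.

Section Assembly.
Variables (K : fieldType) (L : vectType K) (br : {bilinear L -> L -> L}).
Variables (n : nat) (g : nat -> L) (x1 x2 : L).
Definition ext_basis i : L :=
  if (i <= n)%N then g (M10_pos n i) else if i == (n + 1)%N then x1 else x2.

Lemma ext_basis_x1 : ext_basis (n + 1) = x1.
Proof. by rewrite /ext_basis addn1 ltnn eqxx. Qed.

Lemma ext_basis_x2 : ext_basis (n + 2) = x2.
Proof.
by rewrite /ext_basis (_ : (n + 2 <= n)%N = false) ?(eqn_add2l n 2 1) //; lia.
Qed.

Lemma ext_basis_M10 i : (0 < i <= n)%N -> ext_basis i = g (M10_pos n i).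
Proof. by rewrite /ext_basis => /andP[_ ->]. Qed.

Hypotheses (hn : (4 <= n)%N) (g_out : forall k, (n <= k)%N -> g k = 0)
  (g_mul0 : forall k, br (g k) (g 0) = g (M10_shift n k))
  (g_mulS : forall k j, br (g k) (g j.+1) = 0)
  (g_x1 : forall k, br (g k) x1 = M10_weight (\row_j [:: 1; 0]`_j) k *: g k)
  (g_x2 : forall k, br (g k) x2 = M10_weight (\row_j [:: 0; 1]`_j) k *: g k)
  (x1_g0 : br x1 (g 0) = - g 0) (x2_g0 : br x2 (g 0) = 0)
  (x1_g : forall k, br x1 (g k.+1) = 0) (x2_g : forall k, br x2 (g k.+1) = 0)
  (x_x : forall u v, u \in [:: x1; x2] -> v \in [:: x1; x2] -> br u v = 0).

Lemma M10_posS i : (1 < i <= n)%N -> exists k, M10_pos n i = k.+1.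
Proof.
rewrite /M10_pos; case: i => [|[|[|i]]] //= _; first by exists 0%N.
by case: eqP => _; [exists 1%N | exists i.+2].
Qed.

Lemma lincomb_M10_table i : (0 < i <= n)%N ->
  lincomb ext_basis (M10_table K n (n + 2) i 1) = g (M10_shift n (M10_pos n i)).
Proof.
move=> ile; rewrite /M10_table eqxx !andbT.
have ebasE j k : (0 < j <= n)%N -> M10_pos n j = k ->
    lincomb ext_basis (ebas K (n + 2) j) = g k.
  by move=> jn <-; rewrite lincomb_ebas ?ext_basis_M10 //; lia.
have [->|i1] := eqVneq i 1%N.
  apply: ebasE; rewrite /M10_pos /M10_shift ?eqxx //=; first by lia.
  by rewrite ifN //; lia.
have [ilt|ige] := boolP (2 <= i <= n - 2)%N.
  apply: ebasE; first by lia.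
  rewrite /M10_pos; case: i i1 ile ilt => [|[|[|i]]] // _ _ ilt.
    by rewrite /= ifN //; lia.
  by rewrite /= !ifN //; lia.
(* There remain [i = n - 1] and [i = n], both shifted to index [n], where [g] is zero. *)
rewrite linear0 /M10_pos ifN; last by lia.
by case: eqP => ein; rewrite g_out // /M10_shift /= ?ifN //; lia.
Qed.

Lemma ext_basis_table i j : (0 < i <= n + 2)%N -> (0 < j <= n + 2)%N ->
  br (ext_basis i) (ext_basis j) = lincomb ext_basis (ext_table K n i j).
Proof.
have range k : (0 < k <= n + 2)%N ->
    [\/ (0 < k <= n)%N, k = (n + 1)%N | k = (n + 2)%N].
  move=> /andP[k0 k2]; have [kn|kn] := leqP k n; first by apply: Or31; rewrite k0.
  have [->|k1] := eqVneq k (n + 1)%N; first exact: Or32.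
  by apply: Or33; lia.
have xE : {subset [:: ext_basis (n + 1); ext_basis (n + 2)] <= [:: x1; x2]}.
  by move=> u; rewrite ext_basis_x1 ext_basis_x2.
have F i' : (0 < i' <= n + 2)%N ->
    lincomb ext_basis (ebas K (n + 2) i') = ext_basis i'.
  exact: lincomb_ebas.
have pos_n : M10_pos n n = 2%N by rewrite /M10_pos ifN ?eqxx //; lia.
have pos_mid k : (2 < k < n)%N -> M10_pos n k = k.
  by move=> kn; rewrite /M10_pos !ifN //; lia.
have FZ (c : K) v : lincomb ext_basis (c *: v : 'rV_(n + 2)) = c *: lincomb ext_basis v.
  exact: linearZ.
have FN v : lincomb ext_basis (- v : 'rV_(n + 2)) = - lincomb ext_basis v.
  exact: linearN.
have n1n : (n + 1 <= n)%N = false by lia.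
have n2n : (n + 2 <= n)%N = false by lia.
have n21 : (n + 2 == n + 1)%N = false by lia.
have n11 : (n + 1 == 1)%N = false by lia.
have n21' : (n + 2 == 1)%N = false by lia.
move=> /range[ile|->|->] /range[jle|->|->]; rewrite /ext_table.
- have [_ in_] := andP ile; have [_ jn] := andP jle.
  rewrite in_ jn /= !ext_basis_M10 //.
  have [->|j1] := eqVneq j 1%N; first by rewrite lincomb_M10_table // g_mul0.
  have [|k ->] := @M10_posS j; first by lia.
  by rewrite g_mulS /M10_table (negPf j1) !andbF linear0.
- rewrite n1n andbF eqxx ext_basis_x1 ext_basis_M10 // g_x1.
  rewrite /M10_weight !mxE /=.
  have [->|i1] := eqVneq i 1%N.
    by rewrite F ?ext_basis_M10 ?scale1r //; lia.
  have [->|i2] := eqVneq i 2%N.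
    have -> : (2 == n)%N = false by lia.
    by rewrite scale0r linear0.
  have [ein|nin] := eqVneq i n.
    have -> : (3 <= i <= n - 1)%N = false by lia.
    by rewrite ein pos_n FZ F ?ext_basis_M10 ?pos_n //; lia.
  have -> : (3 <= i <= n - 1)%N = true by lia.
  rewrite FZ F ?ext_basis_M10; try lia.
  rewrite pos_mid; last by lia.
  have [-> -> ->] : [/\ (i == 0)%N = false, (i == 1)%N = false & (i == 2)%N = false].
    by split; lia.
  by rewrite add0r.
- rewrite n2n andbF n21 eqxx ext_basis_x2 ext_basis_M10 // g_x2.
  rewrite /M10_weight !mxE /= !mul0rn addr0.
  have [->|i1] := eqVneq i 1%N; first by rewrite scale0r linear0.
  have [ein|nin] := eqVneq i n.
    have -> : (2 <= i <= n - 1)%N = false by lia.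
    by rewrite ein pos_n scale0r linear0.
  rewrite (_ : (2 <= i <= n - 1)%N = true); last by lia.
  rewrite F ?ext_basis_M10; try lia.
  have [k ek] : exists k, M10_pos n i = k.+1 by apply: M10_posS; lia.
  have k1 : k != 1%N.
    by move: ek; rewrite /M10_pos (negPf nin); case: ifP => i2; lia.
  by rewrite ek; case: k k1 {ek} => [|[|k]] //= _; rewrite scale1r.
- rewrite n1n /= ext_basis_x1 ext_basis_M10 //.
  have [-> ->] : (j == n + 1)%N = false /\ (j == n + 2)%N = false by lia.
  rewrite eqxx /=; have [->|j1] := eqVneq j 1%N.
    rewrite FN F ?ext_basis_M10; try lia.
    exact: x1_g0.
  have [|k ->] := @M10_posS j; first by lia.
  by rewrite x1_g linear0.
- rewrite n1n /= eqxx n11 x_x ?xE ?inE ?eqxx ?orbT //.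
  by rewrite !ifN ?linear0 //; lia.
- rewrite n1n /= n21 eqxx x_x ?xE ?inE ?eqxx ?orbT //.
  by rewrite !ifN ?linear0 //; lia.
- rewrite n2n /= ext_basis_x2 ext_basis_M10 // n21.
  have [-> ->] : (j == n + 1)%N = false /\ (j == n + 2)%N = false by lia.
  rewrite linear0; have [->|j1] := eqVneq j 1%N; first exact: x2_g0.
  have [|k ->] := @M10_posS j; first by lia.
  by rewrite x2_g.
- rewrite n2n /= eqxx n21' x_x ?xE ?inE ?eqxx ?orbT //.
  by rewrite !ifN ?linear0 //; lia.
- rewrite n2n /= n21 eqxx x_x ?xE ?inE ?eqxx ?orbT //.
  by rewrite !ifN ?linear0 //; lia.
Qed.

End Assembly.

(** * The classification over a field of characteristic zero *)

Lemma M10_extension_isomorphic (K : fieldType) (n : nat) (L : vectType K)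
    (br : {bilinear L -> L -> L}) (N : {vspace L}) :
  injective (fun i : nat => i%:R : K) -> (4 <= n)%N ->
  leibniz_identity br -> \dim {:L} = (n + 2)%N -> solvable br {:L} ->
  nilradical br N -> isomorphic_onto (@M10_bracket K n) br N ->
  isomorphic_onto (@ext_bracket K n) br {:L}.
Proof.
move=> natr_inj hn hLeibniz hdim hsolv hN /(exists_M10_basis hn)[b bM eN].
rewrite -{}eN in hN; have [idN _ _] := hN.
have [phi phiP] := exists_M10_weights bM hn hLeibniz idN.
have bracketN := bracket_nilradical hLeibniz hn bM hN hdim hsolv phiP.
have phi_onto := phi_surj hLeibniz hn bM hN hdim hsolv phiP.
have [h phi_h] := phi_onto (\row_j [:: 1; n%:R]`_j).
have [x1 phi_x1 x1h] := exists_torus hn natr_inj bM phiP bracketN phi_h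
  (phi_onto (\row_j [:: 1; 0]`_j)).
have [x2 phi_x2 x2h] := exists_torus hn natr_inj bM phiP bracketN phi_h
  (phi_onto (\row_j [:: 0; 1]`_j)).
have [g0 g0P g0h] := torus_eigenvector hn natr_inj bM phiP phi_h (isT : (0 < 2)%N).
have [g1 g1P g1h] := torus_eigenvector hn natr_inj bM phiP phi_h (isT : (1 < 2)%N).
rewrite /M10_hweight /= ?scale1r ?subn0 ?addnK in g0h g1h.
pose g := M10_chain br g0 g1.
have weight x := chain_weight hLeibniz hn natr_inj bM phiP bracketN phi_h
  g0P g1P g0h g1h (x := x).
have left0 x := torus_chain0 hLeibniz hn natr_inj bM phiP bracketN phi_h
  g0P g1P g0h g1h (x := x).
have leftS x := torus_chainS hLeibniz hn natr_inj bM phiP bracketN phi_h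
  g0P g1P g0h g1h (x := x).
apply: (@table_isomorphic _ _ _ _ _ (ext_basis n g x1 x2)) => // [U HU|].
  have Ug k : (k < n)%N -> g k \in U.
    move=> kn; have -> : g k = ext_basis n g x1 x2 (M10_index n k).
      rewrite ext_basis_M10 /M10_pos /M10_index; last first.
        by case: k kn => [|[|[|k]]] //= kn; rewrite ?kn; lia.
      by case: k kn => [|[|[|k]]] //= kn; rewrite ?kn ?eqxx ?ifN //; lia.
    by apply: HU; rewrite /M10_index; case: k kn => [|[|[|k]]] //= kn; rewrite ?kn; lia.
  have sNU : (flag n b 0 <= U)%VS.
    apply: (flag_span_unitri (M10_out bM) (g := g)) => // k _.
    exact: (chain_unitri hn bM g0P g1P).
  have Ux1 : x1 \in U by rewrite -(ext_basis_x1 n g x1 x2) HU //; lia.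
  have Ux2 : x2 \in U by rewrite -(ext_basis_x2 n g x1 x2) HU //; lia.
  apply/vspaceP=> v; rewrite memvf.
  (* Removing from [v] the part in [x1] and [x2] read off by [phi] leaves an element of the kernel
     of [phi], hence of the nilradical, which the chain spans. *)
  rewrite -(subrK (phi v 0 0 *: x1 + phi v 0 1 *: x2) v).
  rewrite memvD //; last by rewrite memvD ?memvZ.
  apply: (subvP sNU).
  apply: (subvP (lker_phi hLeibniz hn bM hN hdim hsolv phiP)).
  rewrite memv_ker linearB linearD !linearZ /= phi_x1 phi_x2; apply/eqP/rowP.
  move=> j; rewrite !mxE; case: j => [[|[|]]] //= jP.
    by rewrite mulr1 mulr0 addr0 (_ : Ordinal jP = 0) ?subrr //; apply: val_inj.
  by rewrite mulr1 mulr0 add0r (_ : Ordinal jP = 1) ?subrr //; apply: val_inj.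
apply: ext_basis_table => //.
- exact: (chain_out hn bM g0P g1P).
- exact: (chain_mulE hLeibniz hn natr_inj bM phiP bracketN phi_h g0P g1P).
- exact: (chain_mulS hn bM g0P g1P).
- by move=> k; rewrite weight // phi_x1.
- by move=> k; rewrite weight // phi_x2.
- by rewrite left0 // phi_x1 mxE scaleN1r.
- by rewrite left0 // phi_x2 mxE oppr0 scale0r.
- by move=> k; rewrite leftS.
- by move=> k; rewrite leftS.
move=> u v Hu Hv; apply: (torus_abelian hLeibniz hn natr_inj bM phiP bracketN phi_h).
  by move: Hu; rewrite !inE => /orP[] /eqP->.
by move: Hv; rewrite !inE => /orP[] /eqP->.
Qed.

Theorem theorem3p9 (R : realType) (n : nat) (hn : (4 <= n)%N)
    (L : vectType R[i]) (br : {bilinear L -> L -> L})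
    (hLeibniz : leibniz_identity br)
    (hdim : \dim {:L} = (n + 2)%N)
    (hsolv : solvable br {:L})
    (N : {vspace L}) (hN : nilradical br N)
    (hM : isomorphic_onto (@M10_bracket R[i] n) br N) :
  isomorphic_onto (@ext_bracket R[i] n) br {:L}.
Proof.
have natr_inj : injective (fun i : nat => i%:R : R[i]).
  by move=> i j /eqP; rewrite Num.Theory.eqr_nat => /eqP.
exact: M10_extension_isomorphic natr_inj hn hLeibniz hdim hsolv hN hM.
Qed.
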